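(* Let $X$ be a non-empty set equipped with the discrete topology. The compactification $\mathcal{U}(\mathcal{P}(X))$ of $X$ is the Stone-Čech compactification of $X$.
   Context: A compactification of a topological space $X$ is a compact Hausdorff space $Y$ that contains a dense subset homeomorphic to $X$. Given a compactification $Y$ of $X$ with an embedding $\alpha:X\to Y$ such that $\alpha(X)$ is dense in $Y$, $Y$ is called the Stone-Čech compactification of $X$ if for every compact Hausdorff space $K$, every continuous map $f:\alpha(X)\to K$ admits a continuous extension $\widetilde{f}:Y\to K$. $\mathcal{P}(X)$ is the power set Boolean algebra of $X$ (join $\cup$, meet $\cap$, complement $X\setminus A$). $\mathcal{U}(\mathcal{P}(X))$ is the set of all ultrafilters of $\mathcal{P}(X)$, with the topology having as a basis the sets $U_A=\{F\in\mathcal{U}(\mathcal{P}(X)):A\in F\}$, $A\in\mathcal{P}(X)$. The embedding used for $\mathcal{U}(\mathcal{P}(X))$ is $\alpha:X\to\mathcal{U}(\mathcal{P}(X))$, $\alpha(x)=F_x:=\{A\in\mathcal{P}(X):x\in A\}$. *)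

(* Defs.v *)
From HB Require Import structures.
From mathcomp Require Import all_boot all_order all_algebra.
From mathcomp Require Import all_classical topology.
Set Implicit Arguments.
Unset Strict Implicit.
Unset Printing Implicit Defensive.
Local Open Scope classical_set_scope.

Definition homeomorphism (X Y : topologicalType) (f : X -> Y) : Prop :=
  continuous f /\ exists g : Y -> X, [/\ continuous g, cancel f g & cancel g f].

(* [range f], used as a type, carries the subspace topology (set_type). *)
Definition corestriction (X Y : Type) (f : X -> Y) (x : X) : range f :=
  exist _ (f x) (mem_set (imageT f x)).

Definition topological_embedding (X Y : topologicalType) (f : X -> Y) : Prop :=
  homeomorphism (corestriction f).

Definition is_compactification (X Y : topologicalType) (alpha : X -> Y) : Prop :=
  [/\ compact [set: Y], hausdorff_space Y, topological_embedding alpha &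
      dense (range alpha)].

Definition is_stone_cech (X Y : topologicalType) (alpha : X -> Y) : Prop :=
  is_compactification alpha /\
  forall K : topologicalType, compact [set: K] -> hausdorff_space K ->
  forall f : range alpha -> K, continuous f ->
  exists2 ftilde : Y -> K,
    continuous ftilde & forall y : range alpha, ftilde (set_val y) = f y.

(* UltraFilter is the library's class of maximal proper filters of subsets,
   i.e. of the ultrafilters of the Boolean algebra P(X). *)
Record ultrafilters (X : Type) := MkUltrafilter {
  ultrafilter_sets : set_system X;
  ultrafilter_ultra : UltraFilter ultrafilter_sets }.

Definition basic_open (X : Type) (A : set X) : set (ultrafilters X) :=
  [set F : ultrafilters X | ultrafilter_sets F A].

Section UltrafilterTopology.
Variable X : Type.

Local Lemma basic_open_cover :
  \bigcup_(A in [set: set X]) basic_open A = [set: ultrafilters X].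
Proof.
apply/seteqP; split=> // -[F FU] _; exists setT => //.
by rewrite /basic_open /=; exact: filterT.
Qed.

Local Lemma basic_open_join (A B : set X) (F : ultrafilters X) :
  [set: set X] A -> [set: set X] B -> basic_open A F -> basic_open B F ->
  exists C, [/\ [set: set X] C, basic_open C F &
                basic_open C `<=` basic_open A `&` basic_open B].
Proof.
move=> _ _; case: F => F FU; rewrite /basic_open /= => FA FB.
exists (A `&` B); split => //; first exact: filterI.
move=> [G GU] /= GAB.
by split; apply: filterS GAB; [exact: subIsetl | exact: subIsetr].
Qed.

HB.instance Definition _ := gen_eqMixin (ultrafilters X).
HB.instance Definition _ := gen_choiceMixin (ultrafilters X).
HB.instance Definition _ := @isBaseTopological.Build (ultrafilters X)
  (set X) setT (@basic_open X) basic_open_cover basic_open_join.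

Lemma basic_open_open (A : set X) : open (basic_open A).
Proof. by exists [set A] => //; rewrite bigcup_set1. Qed.

Lemma basic_open_basis : basis (range (@basic_open X)).
Proof.
split=> [_ [A _ <-]|F V]; first exact: basic_open_open.
rewrite nbhsE => -[W [[D _ WE] WF] WV]; move: WF; rewrite -WE => -[A DA FA].
exists (basic_open A); first by split => //; exists A.
by move=> G GA; apply: WV; rewrite -WE; exists A.
Qed.

Local Lemma point_ultra (x : X) : UltraFilter [set A : set X | A x].
Proof.
suff -> : [set A : set X | A x] = principal_filter x.
  exact: principal_filter_ultra.
by apply/seteqP; split=> [A Ax|A]; [apply/principal_filterP|move/principal_filterP].
Qed.

Definition point_ultrafilter (x : X) : ultrafilters X :=
  MkUltrafilter (point_ultra x).

End UltrafilterTopology.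

(* Main.v *)
Require Import Defs.
From mathcomp Require Import all_boot all_classical topology.
Local Open Scope classical_set_scope.

(** Everything follows from reading an ultrafilter on [X] as a generalized
    point: [basic_open A] is the set of generalized points lying in [A], and
    [A] and its complement cut the space into two complementary open sets.

    - Two distinct ultrafilters disagree on some [A], so they are separated by
      [basic_open A] and [basic_open (~` A)].
    - An ultrafilter [U] on the space of ultrafilters has the limit
      [[set A | U (basic_open A)]], so the space is compact.
    - The only principal ultrafilter in [basic_open [set x]] is that of [x],
      so [X] is embedded as a discrete subspace; and any [x \in A] gives a
      principal ultrafilter in [basic_open A], so this subspace is dense.

    For the universal property, a map [g] from [X] to a compact Hausdorff space
    [K] pushes every ultrafilter [F] on [X] forward to an ultrafilter on [K],
    which has exactly one limit; that limit is the value of the extension at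
    [F].  Continuity at [F] uses the regularity of [K]: a neighbourhood of the
    limit contains the closure of some neighbourhood [V], and for every
    ultrafilter containing [g @^-1` V] the limit stays in [closure V]. *)

(** A proper filter that decides every set cannot grow: a new set [A] would
    meet the complement [~` A] already present. *)
Lemma decisive_ultra {T : Type} (F : set_system T) : ProperFilter F ->
  (forall A, F A \/ F (~` A)) -> UltraFilter F.
Proof.
move=> FP FVC; split=> // G GP FG; apply/seteqP; split=> // A GA.
have [//|/FG GAC] := FVC A.
case: (@filter_not_empty _ G); rewrite -(setICr A); exact: filterI.
Qed.

Lemma ultra_fmap {T U : Type} (f : T -> U) (F : set_system T) :
  UltraFilter F -> UltraFilter (fmap f F).
Proof.
move=> FU; apply: decisive_ultra => A; exact: (in_ultra_setVsetC (f @^-1` A)).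
Qed.

Section SpaceOfUltrafilters.
Context {X : Type}.
Implicit Types (F G : ultrafilters X) (A : set X).

#[local] Instance ultrafilter_setsU F : UltraFilter (ultrafilter_sets F).
Proof. exact: ultrafilter_ultra. Qed.

(** Inclusion suffices for equality because ultrafilters are maximal. *)
Lemma ultrafilters_eq F G :
  ultrafilter_sets F `<=` ultrafilter_sets G -> F = G.
Proof.
move=> FG; have /esym : ultrafilter_sets G = ultrafilter_sets F.
  exact: (max_filter _ FG).
case: F G {FG} => F FU [G GU] /= FG; move: GU; rewrite -FG => GU.
by rewrite (Prop_irrelevance FU GU).
Qed.

Lemma nbhs_basic_open {F A} : basic_open A F -> nbhs F (basic_open A).
Proof.
by move=> FA; apply: open_nbhs_nbhs; split => //; exact: basic_open_open.
Qed.

Lemma nbhs_ultrafilters {F} {W : set (ultrafilters X)} : nbhs F W ->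
  exists2 A, ultrafilter_sets F A & basic_open A `<=` W.
Proof.
by move=> /(basic_open_basis X).2[_ [[A _ <-] FA] AW]; exists A.
Qed.

Lemma hausdorff_ultrafilters : hausdorff_space (ultrafilters X).
Proof.
move=> F G FG; apply: ultrafilters_eq => A FA.
have [//|GAC] := in_ultra_setVsetC A (ultrafilter_ultra G).
have [H [HA HAC]] := FG _ _ (nbhs_basic_open FA) (nbhs_basic_open GAC).
case: (@filter_not_empty _ (ultrafilter_sets H)).
rewrite -(setICr A); exact: filterI.
Qed.

Lemma basic_openC A : basic_open (~` A) = ~` basic_open A.
Proof.
apply/seteqP; split=> F.
  move=> FAC FA; apply: (@filter_not_empty _ (ultrafilter_sets F)).
  rewrite -(setICr A); exact: filterI.
by move=> nFA; have [] := in_ultra_setVsetC A (ultrafilter_ultra F).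
Qed.

(** This ultrafilter will be the limit of [U].  It decides every [A] because
    [basic_open] commutes with complements and [U] decides [basic_open A]. *)
Lemma limit_ultra {U : set_system (ultrafilters X)} : UltraFilter U ->
  UltraFilter [set A | U (basic_open A)].
Proof.
move=> UU; apply: decisive_ultra => [|A]; last first.
  rewrite /= basic_openC; exact: in_ultra_setVsetC.
apply: Build_ProperFilter => [/= U0|].
  apply: (@filter_not_empty _ U); apply: filterS U0 => F F0.
  exact: (@filter_not_empty _ (ultrafilter_sets F)).
split=> /=.
- by apply: filterS filterT => F _; exact: filterT.
- move=> A B UA UB; apply: filterS (@filterI _ U _ _ _ UA UB) => F [FA FB].
  exact: filterI.
- by move=> A B AB; apply: filterS => F; exact: filterS.
Qed.

Lemma compact_ultrafilters : compact [set: ultrafilters X].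
Proof.
rewrite compact_ultra => U UU _; exists (MkUltrafilter (limit_ultra UU)).
split=> // W /nbhs_ultrafilters[A UA AW].
exact: (@filterS _ U _ _ _ AW UA).
Qed.

Lemma dense_point_ultrafilter : dense (range (@point_ultrafilter X)).
Proof.
move=> O [F OF] Oopen.
have [A FA AO] := nbhs_ultrafilters (open_nbhs_nbhs (conj Oopen OF)).
have [x Ax] := filter_ex FA.
by exists (point_ultrafilter x); split; [exact: AO | exists x].
Qed.

(** The universal property before restricting along the embedding: the
    extension sends [F] to the limit of the image of [F] under [g]. *)
Lemma ultrafilter_extension {K : topologicalType} (g : X -> K) :
  compact [set: K] -> hausdorff_space K ->
  exists2 h : ultrafilters X -> K,
    continuous h & forall x, h (point_ultrafilter x) = g x.
Proof.
move=> Kc Kh.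
have /choice[h hlim] F : exists k : K, fmap g (ultrafilter_sets F) --> k.
  move: (Kc); rewrite compact_ultra.
  by move=> /(_ _ (ultra_fmap g _ (ultrafilter_ultra F)) filterT)[k [_ Fk]]; exists k.
exists h => [F W hFW|x].
  have [V hFV VW] := compact_regular Kh Kc filterT hFW.
  apply: filterS (nbhs_basic_open (hlim F V hFV)) => G GV.
  (* [h G] lies in [closure V]: each neighbourhood [B] of it meets [V], since
     the image of [G] contains both. *)
  apply: VW => B /hlim GB.
  exact: (@filter_ex _ (fmap g (ultrafilter_sets G)) _ _ (filterI GV GB)).
(* The image of the principal ultrafilter of [x] is that of [g x], which
   converges to [g x]. *)
have [FP _] := ultra_fmap g _ (ultrafilter_ultra (point_ultrafilter x)).
apply: (@cvg_unique _ Kh _ FP _ _ (hlim (point_ultrafilter x))) => W /=.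
exact: nbhs_singleton.
Qed.

End SpaceOfUltrafilters.

(** The inverse is continuous because [basic_open [set x]] isolates the
    principal ultrafilter of [x] among all principal ultrafilters. *)
Lemma embedding_point_ultrafilter {X : discreteTopologicalType} :
  topological_embedding (@point_ultrafilter X : X -> ultrafilters X).
Proof.
split=> [x W|].
  rewrite nbhs_principalE /= => /nbhs_singleton Wx.
  exact/principal_filterP.
have /choice[g gE] (y : range (@point_ultrafilter X)) :
    exists x, point_ultrafilter x = set_val y.
  by have [x _ xy] := set_valP y; exists x.
have point_inj x (y : X) : point_ultrafilter x = point_ultrafilter y -> x = y.
  move=> /(congr1 (fun F => ultrafilter_sets F [set x])) /= xy.
  by apply/esym; rewrite -xy.
exists g; split=> [y W|x|y].
- rewrite nbhs_principalE => /principal_filterP Wy.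
  have yb : basic_open [set g y] (set_val y) by rewrite -gE.
  have := @initial_continuous _ _ set_val y _ (nbhs_basic_open yb).
  apply: (@filterS _ (nbhs y)) => z /=.
  by rewrite /basic_open /= -gE /= => ->.
- exact/point_inj/gE.
- exact/val_inj/gE.
Qed.

Theorem theorem6p11 (X : discreteTopologicalType) (hX : [set: X] !=set0) :
  is_stone_cech (@point_ultrafilter X : X -> ultrafilters X).
Proof.
split; first split.
- exact: compact_ultrafilters.
- exact: hausdorff_ultrafilters.
- exact: embedding_point_ultrafilter.
- exact: dense_point_ultrafilter.
move=> K Kc Kh f _.
have [h hcont hE] :=
  ultrafilter_extension (f \o corestriction (@point_ultrafilter X)) Kc Kh.
exists h => // y; have [x _ xy] := set_valP y.
have -> : y = corestriction (@point_ultrafilter X) x by exact/val_inj/esym.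
exact: hE.
Qed.
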